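(* Consider the algorithm OPTIMISTIC for the $k$-secretary problem with $k=2$, with sampling threshold $t$ satisfying $t-1 = cn$ where $c = 0.3521$. Then OPTIMISTIC is $0.4168$-competitive, i.e., for every item set, $\mathbb{E}[\mathrm{ALG}] \ge (0.4168 - o(1)) \cdot \mathrm{OPT}$, where $o(1)$ denotes a term tending to $0$ as $n \to \infty$.
   Context: $k$-secretary problem: there are $n$ items with distinct positive values $v_1 > v_2 > \dots > v_n$. The items arrive one by one in an order given by a permutation drawn uniformly at random among all $n!$ permutations. An algorithm may accept at most $k$ items; each decision is made immediately and irrevocably on arrival. $\mathrm{ALG}$ is the sum of accepted values and $\mathrm{OPT} = \sum_{i=1}^k v_i$. OPTIMISTIC with sampling threshold $t$ (integer, $k < t \le n-k$): reject the first $t-1$ items; let $s_1 > \dots > s_k$ be the $k$ best among them. In the selection phase (positions $\ge t$), the $j$-th accepted item is the first item arriving after the $(j-1)$-th accepted item (or after the sampling phase, for $j=1$) that is better than $s_{k-j+1}$; i.e., the algorithm first waits for an item better than $s_k$, then for a subsequent item better than $s_{k-1}$, and so on. Here cn is assumed to be an integer. *)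

(* Defs.v *)
(* MathComp / MathComp-Analysis *)
From HB Require Import structures.
From mathcomp Require Import all_boot all_order all_algebra all_fingroup.
From mathcomp Require Import all_classical all_reals all_analysis.

Set Implicit Arguments.
Unset Strict Implicit.
Unset Printing Implicit Defensive.

Import Order.TTheory GRing.Theory Num.Theory.
Import numFieldNormedType.Exports.

Local Open Scope ring_scope.

(* An online algorithm only sees the arriving items and their values, so
   OPTIMISTIC is defined for an arbitrary item type T and value function v;
   it is meant for pairwise distinct values. *)
Section Optimistic.
Context {R : realType} {T : Type}.
Variable v : T -> R.

Definition best (k : nat) (s : seq T) : seq T :=
  take k (sort (fun x y => v y <= v x) s).

(* [select refs s]: wait for an item of s better than the head of refs, accept
   it, and continue on the rest of s with the tail of refs. *)
Fixpoint select (refs s : seq T) : seq T :=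
  match s, refs with
  | x :: s', r :: refs' =>
      if v r < v x then x :: select refs' s' else select refs s'
  | _, _ => [::]
  end.

(* Positions in s are numbered from 1, so the sampling phase is take (t - 1) s.
   If s_1, ..., s_k are the best items of the sample in decreasing order, the
   reference items are used in the order s_k, s_(k-1), ..., s_1. *)
Definition optimistic (k t : nat) (s : seq T) : seq T :=
  select (rev (best k (take (t - 1) s))) (drop (t - 1) s).

Definition ALG (k t : nat) (s : seq T) : R :=
  \sum_(x <- optimistic k t s) v x.

End Optimistic.

(* Item i : 'I_n is the (i+1)-th best one, of value v i. *)
Definition item_values (R : realType) (n : nat) (v : 'I_n -> R) : Prop :=
  (forall i, 0 < v i) /\ (forall i j : 'I_n, (i < j)%N -> v j < v i).

Definition OPT (R : realType) (n : nat) (v : 'I_n -> R) (k : nat) : R :=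
  \sum_(i < n | (i < k)%N) v i.

(* s i is the item arriving at the (i+1)-th position. *)
Definition arrivals (n : nat) (s : 'S_n) : seq 'I_n := [seq s i | i <- enum 'I_n].

(* The expectation is over a uniformly random arrival order. *)
Definition expected_ALG (R : realType) (n : nat) (v : 'I_n -> R) (k t : nat) : R :=
  (\sum_(s : 'S_n) ALG v k t (arrivals s)) / n`!%:R.

(* Main.v *)
(**
  Write m = t - 1 = c n.  The best item, arriving at position x, is accepted
  when the best of the first x items lies in the sample, and also when this
  prefix maximum arrives at a position y >= m while the second best of the
  first x items and the two best of the first y items all lie in the sample.  The
  second best item is accepted in the same two cases, except that, if the best
  item lies in the sample, the best of the remaining first x items must lie in
  the sample too.  Swapping arrival positions inside a set S shows that the
  position of the best item of S is uniform on S and independent of what is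
  fixed outside S, so that all these probabilities are explicit.  With
  h = sum_(m <= k < n) 1/k, A = (m - 1)/(n - 1) and
  K = sum_(m <= k < n) 1/(k - 1), they add up to
  p_1 >= c (h + 1 - A (1 + K)) and p_2 >= c h.

  Since v_1 >= v_2, it is enough that the first bound dominates the second one
  and that they sum to at least 2 * 0.4168.
  As cn is an integer, n is a multiple of 10^4, and for such n the bound
  h >= 1.0436 already gives this, without any error term.
*)
Require Import Defs.
From HB Require Import structures.
From mathcomp Require Import all_boot all_order all_algebra all_fingroup.
From mathcomp Require Import all_classical all_reals all_analysis.
From mathcomp Require Import ring lra zify.

Set Implicit Arguments.
Unset Strict Implicit.
Unset Printing Implicit Defensive.

Import Order.TTheory GRing.Theory Num.Theory.
Import numFieldNormedType.Exports.

Local Open Scope ring_scope.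

(** * The selection rule with two reference items *)

Section Selection.
Context {R : realType} {T : eqType}.
Variable v : T -> R.
Implicit Types (r x : T) (refs s u w : seq T).

Lemma select_subseq refs s : subseq (select v refs s) s.
Proof.
elim: s refs => [|x s IHs] [|r refs] //=.
case: ifP => _; first by rewrite eqxx.
exact: subseq_trans (IHs _) (subseq_cons _ _).
Qed.

Lemma select_skip r refs u w :
  {in u, forall z, v z <= v r} ->
  select v (r :: refs) (u ++ w) = select v (r :: refs) w.
Proof.
elim: u => //= z u IHu le_r; rewrite ltNge le_r ?mem_head //= IHu // => y uy.
by apply: le_r; rewrite inE uy orbT.
Qed.

Lemma mem_select1 r refs u x w :
  {in u, forall z, v z <= v r} -> v r < v x ->
  x \in select v (r :: refs) (u ++ x :: w).
Proof. by move=> le_r lt_x; rewrite select_skip //= lt_x mem_head. Qed.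

(** At most one item of [u] is accepted: once [r2] is used up, the reference is [r1], which no item
    of [u] beats. So a reference is left for [x], which beats both. *)
Lemma mem_select2 r1 r2 u x w :
  v r2 <= v r1 -> {in u, forall z, v z <= v r1} -> v r1 < v x ->
  x \in select v [:: r2; r1] (u ++ x :: w).
Proof.
move=> le21 le_r1 lt_x; elim: u le_r1 => [_|z u IHu le_r1] /=.
  by rewrite (le_lt_trans le21 lt_x) mem_head.
have le_u : {in u, forall z, v z <= v r1}.
  by move=> y uy; apply: le_r1; rewrite inE uy orbT.
case: ifP => _; last exact: IHu.
by rewrite inE mem_select1 ?orbT.
Qed.

Lemma mem_select_after r1 r2 u1 y u2 x w :
  {in u1, forall z, v z <= v r2} -> v r2 < v y ->
  {in u2, forall z, v z <= v r1} -> v r1 < v x ->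
  x \in select v [:: r2; r1] (u1 ++ y :: u2 ++ x :: w).
Proof.
move=> le_r2 lt_y le_r1 lt_x; rewrite select_skip //= lt_y inE.
by rewrite mem_select1 ?orbT.
Qed.

End Selection.

(** * Arrival prefixes and their best items *)

Section Prefix.
Variable n : nat.
Implicit Types (s : 'S_n) (p q x : 'I_n) (S : {set 'I_n}).

(** Positions count from 0, so for [t = m.+1] the sample occupies the positions below [m]. *)
Definition before (k : nat) : {set 'I_n} := [set p : 'I_n | (p < k)%N].

Lemma card_before k : (k <= n)%N -> #|before k| = k.
Proof.
move=> le_kn; rewrite cardsE -sum1_card.
by rewrite (big_ord_narrow le_kn) sum1_card card_ord.
Qed.

Lemma card_beforeD1 k p : (p < k)%N -> (k <= n)%N ->
  #|before k :\ p| = k.-1.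
Proof.
move=> lt_pk le_kn; have := cardsD1 p (before k).
by rewrite card_before // inE lt_pk add1n => /(congr1 predn) /= <-.
Qed.

Lemma mem_arrivals_slice s j k p :
  (s p \in drop j (take k (arrivals s))) = (j <= p < k)%N.
Proof.
rewrite /arrivals -map_take -map_drop (mem_map perm_inj).
rewrite -(mem_map val_inj) map_drop map_take val_enum_ord take_iota drop_iota.
rewrite mem_iota /=; have := ltn_ord p; lia.
Qed.

Lemma mem_arrivals_take s k p : (s p \in take k (arrivals s)) = (p < k)%N.
Proof. by have := mem_arrivals_slice s 0 k p; rewrite drop0. Qed.

Lemma uniq_arrivals s : uniq (arrivals s).
Proof. by rewrite map_inj_uniq ?enum_uniq //; exact: perm_inj. Qed.

Lemma arrivals_split s j x : (j <= x)%N ->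
  drop j (arrivals s) =
    drop j (take x (arrivals s)) ++ s x :: drop x.+1 (arrivals s).
Proof.
move=> le_jx.
have sz : size (arrivals s) = n by rewrite size_map size_enum_ord.
rewrite -{1}(cat_take_drop x (arrivals s)) drop_cat size_take sz ltn_ord.
have -> : drop x (arrivals s) = s x :: drop x.+1 (arrivals s).
  rewrite (drop_nth (s x)) ?sz // (nth_map x) ?size_enum_ord //.
  by rewrite nth_ord_enum.
case: ltngtP le_jx => // -> _.
by rewrite subnn drop0 (@drop_oversize _ x) // size_take sz ltn_ord.
Qed.

(** Items are numbered from the best down, so the best one has the least index. Comparing indices
    keeps these events independent of [v]. *)
Definition best_at s S p : bool :=
  (p \in S) && [forall (q | q \in S), (s p <= s q)%N].

Lemma best_atP s S p :
  reflect (p \in S /\ forall q, q \in S -> (s p <= s q)%N) (best_at s S p).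
Proof. by apply: (iffP andP) => -[pS /forall_inP]. Qed.

Lemma best_at_uniq s S p q : best_at s S p -> best_at s S q -> p = q.
Proof.
move=> /best_atP[pS minp] /best_atP[qS minq]; apply: (@perm_inj _ s).
by apply/val_inj/eqP; rewrite eqn_leq minp ?minq.
Qed.

Lemma best_at_exists s S q : q \in S -> exists p, best_at s S p.
Proof.
move=> qS; case: (arg_minnP (fun p => nat_of_ord (s p)) qS) => p pS minp.
by exists p; apply/best_atP.
Qed.

Lemma best_atS s S S' p : S' \subset S -> p \in S' ->
  best_at s S p -> best_at s S' p.
Proof.
move=> /fintype.subsetP sub pS' /best_atP[_ minp]; apply/best_atP; split=> // q qS'.
exact/minp/sub.
Qed.

End Prefix.

(** * Sufficient conditions for acceptance *)

Section Acceptance.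
Context {R : realType} {n : nat}.
Variable v : 'I_n -> R.
Hypothesis itemv : item_values v.
Variable m : nat.
Hypothesis m_gt1 : (1 < m)%N.
Implicit Types (s : 'S_n) (a b c x y : 'I_n).

Lemma item_values_lt i j : (v i < v j) = (j < i)%N.
Proof.
have [_ dec] := itemv.
case: (ltngtP j i) => [/dec->//|/dec lt_ji|/val_inj->]; last by rewrite ltxx.
by apply/negbTE; rewrite -leNgt ltW.
Qed.

Lemma item_values_le i j : (v i <= v j) = (j <= i)%N.
Proof. by rewrite leNgt item_values_lt ltnNge negbK. Qed.

(** Distinct values make the order on items antisymmetric, so the sample has only one sorted
    arrangement. *)
Lemma best2_take s a b : best_at s (before n m) a ->
  best_at s (before n m :\ a) b -> best v 2 (take m (arrivals s)) = [:: s a; s b].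
Proof.
move=> /best_atP[]; rewrite inE => lt_am min_a.
move=> /best_atP[]; rewrite !inE => /andP[neq_ba lt_bm] min_b.
pose r := fun i j : 'I_n => v j <= v i.
have r_tr : transitive r by move=> j i k rij rjk; exact: le_trans rjk rij.
have r_total : total r by move=> i j; exact: le_total.
have r_anti : antisymmetric r.
  move=> i j; rewrite /r !item_values_le => /andP[le_ij le_ji].
  by apply/val_inj/eqP; rewrite eqn_leq le_ij.
pose S := take m (arrivals s).
have S_uniq : uniq S by rewrite take_uniq // uniq_arrivals.
have Sa : s a \in S by rewrite mem_arrivals_take.
have Sb : s b \in rem (s a) S.
  by rewrite mem_rem_uniq // inE (inj_eq perm_inj) neq_ba mem_arrivals_take.
pose S' := rem (s b) (rem (s a) S).
have permS : perm_eq S [:: s a, s b & sort r S'].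
  apply: (perm_trans (perm_to_rem Sa)); rewrite perm_cons.
  apply: (perm_trans (perm_to_rem Sb)); rewrite perm_cons.
  by rewrite perm_sym perm_sort.
have S'P i : i \in S' -> exists p, [/\ i = s p, p != a & (p < m)%N].
  rewrite (mem_rem_uniq _ (rem_uniq _ S_uniq)) !inE (mem_rem_uniq _ S_uniq) !inE.
  case/and3P=> _ neq_i; rewrite -(permKV s i) mem_arrivals_take => lt_im.
  exists ((s^-1)%g i); split=> //.
  by rewrite -(inj_eq (@perm_inj _ s)) permKV.
have sortedS : sorted r [:: s a, s b & sort r S'].
  rewrite /= {1}/r item_values_le min_a ?inE //=.
  rewrite (path_sortedE r_tr) sort_sorted // andbT all_sort.
  apply/allP => i /S'P[p [-> neq_pa lt_pm]].
  by rewrite /r item_values_le min_b // !inE neq_pa.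
rewrite /best (sorted_eq r_tr r_anti (sort_sorted r_total S) sortedS) //=.
  by rewrite take0.
by rewrite perm_sort.
Qed.

Lemma optimistic2E s a b : best_at s (before n m) a ->
  best_at s (before n m :\ a) b ->
  optimistic v 2 m.+1 (arrivals s) =
    select v [:: s b; s a] (drop m (arrivals s)).
Proof. by move=> ba bb; rewrite /optimistic subn1 /= (best2_take ba bb). Qed.

Lemma slice_le s S p j k : best_at s S p ->
  (forall q : 'I_n, (j <= q < k)%N -> q \in S) ->
  {in drop j (take k (arrivals s)), forall i, v i <= v (s p)}.
Proof.
move=> /best_atP[_ minp] sub i; rewrite -(permKV s i) mem_arrivals_slice.
by move=> /sub/minp; rewrite item_values_le.
Qed.

Lemma before_second_exists s a : (m <= n)%N -> (a < m)%N ->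
  exists b, best_at s (before n m :\ a) b.
Proof.
move=> le_mn lt_am.
have /card_gt0P[q] : (0 < #|before n m :\ a|)%N.
  by rewrite card_beforeD1 //; lia.
exact: best_at_exists.
Qed.

(** No item before [x] beats [s a], the better reference, so at most one reference is used up when
    [x] arrives. *)
Lemma accept_best_in_sample s a x : (a < m)%N -> (m <= x)%N ->
  best_at s (before n x) a -> (s x < s a)%N ->
  s x \in optimistic v 2 m.+1 (arrivals s).
Proof.
move=> lt_am le_mx best_a lt_xa.
have lt_xn := ltn_ord x.
have sub : before n m \subset before n x.
  by apply/fintype.subsetP => p; rewrite !inE; lia.
have best_a' : best_at s (before n m) a by apply: (best_atS _ _ best_a); rewrite ?inE.
have [|b best_b] := @before_second_exists s a _ lt_am; first by lia.
rewrite (optimistic2E best_a' best_b) (arrivals_split s le_mx) mem_select2 //.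
- have /best_atP[] := best_b; rewrite !inE => /andP[_ lt_bm] _.
  by rewrite item_values_le; case/best_atP: best_a' => _; apply; rewrite inE.
- by apply: slice_le best_a _ => q; rewrite inE => /andP[].
- by rewrite item_values_lt.
Qed.

Lemma accept_best2_in_sample s a b x : (a < m)%N -> (b < m)%N -> (m <= x)%N ->
  best_at s (before n x) a -> best_at s (before n x :\ a) b -> (s x < s b)%N ->
  s x \in optimistic v 2 m.+1 (arrivals s).
Proof.
move=> lt_am lt_bm le_mx best_a best_b lt_xb.
have sub : before n m \subset before n x.
  by apply/fintype.subsetP => p; rewrite !inE; lia.
have best_a' : best_at s (before n m) a by apply: (best_atS _ _ best_a); rewrite ?inE.
have best_b' : best_at s (before n m :\ a) b.
  apply: (best_atS _ _ best_b); first exact: finset.setSD.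
  by have /best_atP[] := best_b; rewrite !inE => /andP[->].
rewrite (optimistic2E best_a' best_b') (arrivals_split s le_mx) mem_select1 //.
  apply: slice_le best_b _ => q; rewrite !inE => /andP[le_mq ->].
  by rewrite andbT; apply: contraTneq lt_am => <-; rewrite -leqNgt.
by rewrite item_values_lt.
Qed.

(** As [y] lies outside the sample, the references are [s c] and then [s b]. The first item to beat
    [s c] is [s y], and after it nothing before [x] beats [s b]. *)
Lemma accept_best_selected s x y b c :
  (m <= y)%N -> (y < x)%N -> (b < m)%N -> (c < m)%N ->
  best_at s (before n x) y -> best_at s (before n x :\ y) b ->
  best_at s (before n y :\ b) c -> (s x < s b)%N ->
  s x \in optimistic v 2 m.+1 (arrivals s).
Proof.
move=> le_my lt_yx lt_bm lt_cm best_y best_b best_c lt_xb.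
have best_b' : best_at s (before n m) b.
  apply: (best_atS _ _ best_b); last by rewrite inE.
  apply/fintype.subsetP => p; rewrite !inE -val_eqE /=; lia.
have best_c' : best_at s (before n m :\ b) c.
  apply: (best_atS _ _ best_c).
    by apply: finset.setSD; apply/fintype.subsetP => p; rewrite !inE; lia.
  by have /best_atP[] := best_c; rewrite !inE => /andP[->].
rewrite (optimistic2E best_b' best_c') (arrivals_split s le_my).
rewrite (arrivals_split s lt_yx) mem_select_after //.
- apply: slice_le best_c _ => q; rewrite !inE -val_eqE /=; lia.
- have [_ min_y] := best_atP _ _ _ best_y.
  rewrite item_values_lt ltn_neqAle val_eqE (inj_eq perm_inj) -val_eqE /=.
  by rewrite min_y ?inE ?andbT; lia.
- apply: slice_le best_b _ => q; rewrite !inE -val_eqE /=; lia.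
- by rewrite item_values_lt.
Qed.

End Acceptance.

(** * Uniform arrival orders and exchangeable positions *)

Section Probability.
Context {R : realType} {n : nat}.
Implicit Types (A B : 'S_n -> bool) (S : {set 'I_n}) (p q x : 'I_n).

Definition prob A : R := #|[pred s | A s]|%:R / n`!%:R.

Lemma card_predE A : #|[pred s | A s]| = (\sum_(s : 'S_n) A s)%N.
Proof.
by rewrite -sum1_card big_mkcond; apply: eq_bigr => s _; rewrite inE; case: (A s).
Qed.

Lemma fact_gt0R : 0 < n`!%:R :> R.
Proof. by rewrite ltr0n fact_gt0. Qed.

Lemma eq_prob A B : A =1 B -> prob A = prob B.
Proof. by move=> eqAB; rewrite /prob (eq_card (B := [pred s | B s])). Qed.

Lemma prob_le A B : (forall s, A s -> B s) -> prob A <= prob B.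
Proof.
move=> subAB; rewrite ler_pM2r ?invr_gt0 ?fact_gt0R // ler_nat.
by apply: subset_leq_card; apply/fintype.subsetP => s; exact: subAB.
Qed.

Lemma prob_split A B :
  prob A = prob (fun s => A s && B s) + prob (fun s => A s && ~~ B s).
Proof.
rewrite /prob -mulrDl -natrD !card_predE -big_split /=; congr (_%:R / _).
by apply: eq_bigr => s _; case: (A s) (B s) => -[].
Qed.

Lemma prob_sum_le (I : finType) (D : pred I) (P : I -> 'S_n -> bool) A :
  (forall j s, D j -> P j s -> A s) ->
  (forall j k s, P j s -> P k s -> j = k) ->
  \sum_(j | D j) prob (P j) <= prob A.
Proof.
move=> subA excl; rewrite -mulr_suml -natr_sum.
rewrite ler_pM2r ?invr_gt0 ?fact_gt0R // ler_nat card_predE.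
under eq_bigr do rewrite card_predE.
rewrite exchange_big /=; apply: leq_sum => s _.
case: (pickP [pred j | D j && P j s]) => [j /= /andP[Dj Pj]|noP].
  rewrite (bigD1 j) //= big1 ?addn0 ?Pj ?(subA _ _ Dj Pj) // => k /andP[_ neq].
  by case: (boolP (P k s)) => // /excl/(_ Pj) eq_kj; rewrite eq_kj eqxx in neq.
by rewrite big1 // => j Dj; have /= := noP j; rewrite Dj /= => ->.
Qed.

(** Swapping the arrivals at [p] and [q] matches the orders in which [Q] marks [q] with those in
    which it marks [p]. As [A] forces exactly one marked position, all positions of [S] have equal
    shares. *)
Lemma prob_exchangeable A (Q : 'S_n -> 'I_n -> bool) S p :
  (forall p q s, p \in S -> q \in S -> A (tperm p q * s)%g = A s) ->
  (forall p q s, p \in S -> q \in S -> Q (tperm p q * s)%g p = Q s q) ->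
  (forall s, A s -> exists2 q, q \in S & Q s q) ->
  (forall s p q, Q s p -> Q s q -> p = q) ->
  p \in S -> prob (fun s => A s && Q s p) = prob A / #|S|%:R.
Proof.
move=> swapA swapQ exQ uniqQ pS.
have S_gt0 : (0 < #|S|)%N by apply/card_gt0P; exists p.
suff eqA : (#|[pred s | A s]| = #|[pred s | A s && Q s p]| * #|S|)%N.
  by rewrite /prob eqA natrM [RHS]mulrAC mulfK // pnatr_eq0 -lt0n.
transitivity (\sum_(q in S) #|[pred s | A s && Q s q]|)%N.
  under eq_bigr do rewrite card_predE.
  rewrite exchange_big card_predE /=; apply: eq_bigr => s _.
  case: (boolP (A s)) => [/exQ[q qS Qq]|_]; last by rewrite big1.
  rewrite (bigD1 q) //= Qq big1 ?addn0 // => k /andP[_ neq_kq].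
  by case: (boolP (Q s k)) => [/uniqQ/(_ Qq) eq_kq|_]; rewrite ?eq_kq ?eqxx // in neq_kq *.
rewrite mulnC -sum_nat_const; apply: eq_bigr => q qS.
rewrite !card_predE (reindex_inj (mulgI (tperm q p))) /=.
by apply: eq_bigr => s _; rewrite swapA // swapQ.
Qed.

(** Stands for independence from the order inside [S]; transpositions are all that the counting
    argument needs. *)
Definition swap_invariant S A :=
  forall p q s, p \in S -> q \in S -> A (tperm p q * s)%g = A s.

Lemma swap_invariant_at S x i : x \notin S ->
  swap_invariant S (fun s => s x == i).
Proof.
by move=> xS p q s pS qS; rewrite permM tpermD //; apply: contraNneq xS => <-.
Qed.

Lemma tperm_mem S p q x : p \in S -> q \in S -> (tperm p q x \in S) = (x \in S).
Proof. by move=> pS qS; case: tpermP => [->|->|//]; rewrite ?pS ?qS. Qed.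

Lemma best_at_tperm S p q x (s : 'S_n) : p \in S -> q \in S ->
  best_at (tperm p q * s)%g S x = best_at s S (tperm p q x).
Proof.
move=> pS qS; apply/best_atP/best_atP => -[xS min_x]; split.
- by rewrite tperm_mem.
- move=> r rS; have := min_x (tperm p q r).
  by rewrite tperm_mem // !permM tpermK; apply.
- by rewrite tperm_mem in xS.
- by move=> r rS; rewrite !permM min_x // tperm_mem.
Qed.

(** A swap inside [S] only permutes the competitors of [x]. *)
Lemma swap_invariant_best S S' x : S \subset S' -> x \notin S ->
  swap_invariant S (fun s => best_at s S' x).
Proof.
move=> /fintype.subsetP sub xS p q s pS qS.
by rewrite best_at_tperm ?sub // tpermD //; apply: contraNneq xS => <-.
Qed.

Lemma swap_invariantI S A B : swap_invariant S A -> swap_invariant S B ->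
  swap_invariant S (fun s => A s && B s).
Proof. by move=> SA SB p q s pS qS; rewrite SA // SB. Qed.

(** Exchangeability with [best_at] as the mark: the position of the best item of [S] is uniform and
    independent of [A]. *)
Lemma prob_best A S p : swap_invariant S A -> p \in S ->
  prob (fun s => A s && best_at s S p) = prob A / #|S|%:R.
Proof.
move=> SA pS; apply: (@prob_exchangeable A (fun s => best_at s S)) => //.
- by move=> a b s aS bS; rewrite best_at_tperm // tpermL.
- move=> s _; have [q best_q] := best_at_exists s pS.
  by exists q => //; case/best_atP: best_q.
- by move=> s; exact: best_at_uniq.
Qed.

Lemma probT : prob xpredT = 1.
Proof.
rewrite /prob (_ : #|_| = n`!) ?divff ?gt_eqF ?fact_gt0R //.
by rewrite -card_Sn; apply: eq_card => s; rewrite !inE.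
Qed.

Lemma prob_at x i : prob (fun s => s x == i) = n%:R^-1.
Proof.
transitivity (prob (fun s => xpredT s && (s x == i))); first exact: eq_prob.
rewrite (@prob_exchangeable _ (fun s x => s x == i) [set: 'I_n]%SET) ?inE //.
- by rewrite probT cardsT card_ord mul1r.
- by move=> p q s _ _; rewrite permM tpermL.
- by move=> s _; exists ((s^-1)%g i); rewrite ?inE ?permKV.
- by move=> s p q /eqP <- /eqP/perm_inj ->.
Qed.

Lemma prob_at2 x p i j : x != p -> i != j ->
  prob (fun s => (s x == i) && (s p == j)) = (n%:R * n.-1%:R)^-1.
Proof.
move=> neq_xp neq_ij.
have xp_setC : p \in (~: [set x])%SET by rewrite !inE eq_sym.
rewrite (@prob_exchangeable _ (fun s p => s p == j) (~: [set x])%SET) //.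
- by rewrite prob_at cardsC1 card_ord invfM.
- move=> a b s aS bS; apply: swap_invariant_at aS bS; by rewrite !inE eqxx.
- by move=> a b s _ _; rewrite permM tpermL.
- move=> s /eqP sx; exists ((s^-1)%g j); rewrite ?permKV //.
  by rewrite !inE; apply: contraNneq neq_ij => eq_x; rewrite -sx -eq_x permKV.
- by move=> s a b /eqP <- /eqP/perm_inj ->.
Qed.

End Probability.

(** * Acceptance probabilities of the two best items *)

Section AcceptanceProbability.
Context {R : realType} {n : nat}.
Variable v : 'I_n -> R.
Hypothesis itemv : item_values v.
Variable m : nat.
Hypothesis m_gt1 : (1 < m)%N.
Hypothesis le_mn : (m <= n)%N.
Implicit Types (s : 'S_n) (i a b c p q x y : 'I_n).

Local Notation accepted i s := (i \in optimistic v 2 m.+1 (arrivals s)).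

(** The factors come from conditioning on ever smaller sets of positions: each event is invariant
    under swaps inside the next set. *)
Lemma prob_best_two i x y b : (y < x)%N -> (b < x)%N -> b != y ->
  prob (fun s => ((s x == i) && best_at s (before n x) y)
                 && best_at s (before n x :\ y) b)
    = (n%:R * x%:R * x.-1%:R)^-1 :> R.
Proof.
move=> lt_yx lt_bx neq_by; have le_xn := ltnW (ltn_ord x).
rewrite prob_best ?inE ?neq_by //.
  rewrite prob_best ?inE //.
    by rewrite prob_at card_before // card_beforeD1 // !invfM.
  by apply: swap_invariant_at; rewrite inE ltnn.
apply: swap_invariantI; first by apply: swap_invariant_at; rewrite !inE ltnn andbF.
by apply: swap_invariant_best; rewrite ?subsetDl // !inE eqxx.
Qed.

(** One more set, [before n y :\ b], joins the chain; it contains none of [x], [y], [b], so the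
    earlier events are invariant inside it. *)
Lemma prob_best_three i x y b c : (y < x)%N -> (b < y)%N -> (c < y)%N -> c != b ->
  prob (fun s => (((s x == i) && best_at s (before n x) y)
                  && best_at s (before n x :\ y) b)
                 && best_at s (before n y :\ b) c)
    = (n%:R * x%:R * x.-1%:R * y.-1%:R)^-1 :> R.
Proof.
move=> lt_yx lt_by lt_cy neq_cb; have lt_xn := ltn_ord x.
have neq_by : b != y by rewrite -val_eqE /=; lia.
have sub_yx : before n y :\ b \subset before n x :\ y.
  by apply/fintype.subsetP => p; rewrite !inE -!val_eqE /=; lia.
have sub_x : before n x :\ y \subset before n x by exact: subsetDl.
rewrite prob_best ?inE ?neq_cb //.
  rewrite prob_best_two // ?card_beforeD1 ?[RHS]invfM //; lia.
apply: swap_invariantI; last by apply: swap_invariant_best; rewrite // !inE eqxx.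
apply: swap_invariantI.
  by apply: swap_invariant_at; rewrite !inE; lia.
apply: swap_invariant_best; first exact: fintype.subset_trans sub_yx sub_x.
by rewrite !inE ltnn andbF.
Qed.

(** The m (m - 1) ordered pairs of distinct sample positions [b], [c] give disjoint events of equal
    probability, each ensuring acceptance. *)
Lemma prob_accept_best_selected i x y : (i <= 1)%N -> (m <= y)%N -> (y < x)%N ->
  m%:R * m.-1%:R / (n%:R * x%:R * x.-1%:R * y.-1%:R) <=
  prob (fun s => ((s x == i) && accepted i s) && best_at s (before n x) y) :> R.
Proof.
move=> le_i1 le_my lt_yx.
pose P b s := ((s x == i) && best_at s (before n x) y)
              && best_at s (before n x :\ y) b.
pose Q b c s := P b s && best_at s (before n y :\ b) c.
have accept_Q b c s : (b < m)%N -> (c < m)%N -> Q b c s -> accepted i s.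
  move=> lt_bm lt_cm /andP[/andP[/andP[/eqP eq_x best_y] best_b] best_c].
  rewrite -eq_x.
  apply: (accept_best_selected itemv m_gt1 le_my lt_yx lt_bm lt_cm best_y best_b best_c).
  (* The item at [b] is worse than the one at [y], so its index is at least 1; as it differs from
     [i], which is at most 1, item [i] beats it. *)
  have [_ min_y] := best_atP _ _ _ best_y.
  have := min_y b; rewrite inE => /(_ ltac:(lia)) le_yb.
  have : s b != s y by rewrite (inj_eq perm_inj) -val_eqE /=; lia.
  have : s b != s x by rewrite (inj_eq perm_inj) -val_eqE /=; lia.
  by rewrite eq_x -!val_eqE /=; lia.
pose w : R := (n%:R * x%:R * x.-1%:R * y.-1%:R)^-1.
pose B := before n m.
apply: (@le_trans _ _ (\sum_(b in B) prob (fun s => P b s && accepted i s))); last first.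
  apply: prob_sum_le => [b s _ /andP[/andP[/andP[-> ->] _] ->]//|b b' s].
  move=> /andP[/andP[_ best_b] _] /andP[/andP[_ best_b'] _].
  exact: best_at_uniq best_b best_b'.
apply: (@le_trans _ _ (\sum_(b in B) \sum_(c in B :\ b) prob (Q b c))).
  have -> : \sum_(b in B) \sum_(c in B :\ b) prob (Q b c) = \sum_(b in B) w *+ m.-1.
    apply: eq_bigr => b; rewrite inE => lt_bm.
    rewrite -(card_beforeD1 lt_bm le_mn) -sumr_const; apply: eq_bigr => c.
    rewrite !inE => /andP[neq_cb lt_cm].
    by apply: prob_best_three => //; lia.
  by rewrite sumr_const card_before // -mulrnA -[leRHS]mulr_natl natrM [(_.-1)%:R * _]mulrC.
apply: ler_sum => b; rewrite inE => lt_bm.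
apply: prob_sum_le => [c s|c c' s].
  by rewrite !inE => /andP[_ lt_cm] Qs; rewrite (accept_Q b c) // andbT; case/andP: Qs.
by move=> /andP[_ best_c] /andP[_ best_c']; exact: best_at_uniq best_c best_c'.
Qed.

Lemma big_slice (F : nat -> R) j k : (k <= n)%N ->
  \sum_(y < n | (j <= y < k)%N) F y = \sum_(j <= l < k) F l.
Proof.
by move=> le_kn; rewrite big_geq_mkord /= -(big_ord_widen_cond _ (fun l => (j <= l)%N)).
Qed.

(** Lower bound for the chance that a given one of the two best items arrives at [k] and is accepted
    while the best item before it arrives at some [l] after the sample. *)
Definition selected_weight (k : nat) : R :=
  \sum_(m <= l < k) m%:R * m.-1%:R / (n%:R * k%:R * k.-1%:R * l.-1%:R).

Lemma prob_accept_split i x : (m <= x)%N ->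
  \sum_(p in before n m)
    prob (fun s => ((s x == i) && accepted i s) && best_at s (before n x) p)
  + \sum_(y < n | (m <= y < x)%N)
    prob (fun s => ((s x == i) && accepted i s) && best_at s (before n x) y)
  <= prob (fun s => (s x == i) && accepted i s) :> R.
Proof.
move=> le_mx; pose P p s := ((s x == i) && accepted i s) && best_at s (before n x) p.
apply: (@le_trans _ _ (\sum_(p in before n x) prob (P p))); last first.
  apply: prob_sum_le => [p s _ /andP[]//|p q s].
  by move=> /andP[_ best_p] /andP[_ best_q]; exact: best_at_uniq best_p best_q.
rewrite [leRHS](bigID (fun p => p \in before n m)) /=.
rewrite lerD // le_eqVlt; apply/orP; left; apply/eqP; apply: eq_bigl => p;
  rewrite !inE; lia.
Qed.

(** The two best items differ only in the case where the best earlier item lies in the sample; [g x]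
    bounds the share of each of the [m] sample positions there. *)
Lemma prob_accept_ge i (g : nat -> R) : (i <= 1)%N ->
  (forall x p : 'I_n, (p < m)%N -> (m <= x)%N ->
    g x <= prob (fun s => ((s x == i) && accepted i s) && best_at s (before n x) p)) ->
  \sum_(m <= k < n) (m%:R * g k + selected_weight k) <= prob (fun s => accepted i s).
Proof.
move=> le_i1 le_g; rewrite -big_slice //.
apply: (@le_trans _ _ (\sum_(x < n | (m <= x < n)%N)
    prob (fun s => (s x == i) && accepted i s))); last first.
  apply: prob_sum_le => [x s _ /andP[]//|x y s].
  by move=> /andP[/eqP <- _] /andP[/eqP/perm_inj ->].
apply: ler_sum => x /andP[le_mx lt_xn]; apply: le_trans (prob_accept_split i le_mx).
apply: lerD; last first.
  rewrite /selected_weight -big_slice; last exact: ltnW.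
  by apply: ler_sum => y /andP[le_my lt_yx]; exact: prob_accept_best_selected.
have -> : m%:R * g x = \sum_(p in before n m) g x.
  by rewrite sumr_const card_before // -[RHS]mulr_natl.
by apply: ler_sum => p; rewrite inE => lt_pm; exact: le_g.
Qed.

Lemma prob_at_best i x p : (p < x)%N ->
  prob (fun s => (s x == i) && best_at s (before n x) p) = (n%:R * x%:R)^-1 :> R.
Proof.
move=> lt_px; rewrite prob_best ?inE //.
  by rewrite prob_at card_before ?invfM // ltnW.
by apply: swap_invariant_at; rewrite inE ltnn.
Qed.

Lemma prob_accept_first i : i = 0%N :> nat ->
  \sum_(m <= k < n) (m%:R * (n%:R * k%:R)^-1 + selected_weight k)
    <= prob (fun s => accepted i s).
Proof.
move=> i0; apply: (@prob_accept_ge i (fun k => (n%:R * k%:R)^-1)) => [|x p lt_pm le_mx].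
  by rewrite i0.
have lt_px : (p < x)%N by lia.
rewrite -(prob_at_best i lt_px).
apply: prob_le => s /andP[/eqP eq_x best_p]; rewrite best_p -eq_x eqxx andbT /=.
apply: (accept_best_in_sample itemv m_gt1 lt_pm le_mx best_p).
rewrite eq_x i0 lt0n -i0 val_eqE -eq_x (inj_eq perm_inj) -val_eqE /=; lia.
Qed.

(** The subtracted term accounts for the orders with the best item [j] at the sample position [p]
    and the best of the other earlier arrivals outside the sample. *)
Lemma prob_accept_second i (j : 'I_n) : i = 1%N :> nat -> j = 0%N :> nat ->
  \sum_(m <= k < n) (m%:R * ((n%:R * k%:R)^-1
      - (n%:R * n.-1%:R)^-1 * (1 - m.-1%:R / k.-1%:R)) + selected_weight k)
    <= prob (fun s => accepted i s).
Proof.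
move=> i1 j0; apply: (@prob_accept_ge i (fun k => (n%:R * k%:R)^-1
    - (n%:R * n.-1%:R)^-1 * (1 - m.-1%:R / k.-1%:R))) => [|x p lt_pm le_mx].
  by rewrite i1.
have lt_px : (p < x)%N by lia.
have lt_xn := ltn_ord x.
have neq_xp : x != p by rewrite -val_eqE /=; lia.
have neq_ij : i != j by rewrite -val_eqE /= i1 j0.
have lt_x (s : 'S_n) q : s x = i -> s q != j -> q != x -> (s x < s q)%N.
  move=> eq_x neq_qj; rewrite -(inj_eq (@perm_inj _ s)) eq_x.
  by move: neq_qj; rewrite -!val_eqE /= i1 j0; lia.
pose A (s : 'S_n) := (s x == i) && (s p == j).
have probA : prob A = (n%:R * n.-1%:R)^-1 :> R by exact: prob_at2.
rewrite (prob_split _ (fun s => s p == j)) mulrBr mulr1 opprB addrCA.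
(* If [p] does not hold [j], item [i] beats [s p]; excluding [A] costs at most its probability. *)
apply: lerD; last first.
  rewrite lerBlDl -(prob_at_best i lt_px).
  rewrite (prob_split (fun s => (s x == i) && _) (fun s => s p == j)) lerD //.
    by rewrite -probA; apply: prob_le => s; rewrite /A => /andP[/andP[-> _] ->].
  apply: prob_le => s /andP[/andP[/eqP eq_x best_p] neq_pj].
  rewrite best_p neq_pj -eq_x eqxx !andbT /=.
  apply: (accept_best_in_sample itemv m_gt1 lt_pm le_mx best_p).
  by apply: lt_x; rewrite // eq_sym.
(* With [j] at [p], position [p] is automatically best; what counts is that the best of the other x
   - 1 arrivals is at one of the m - 1 other sample positions. *)
have -> : (n%:R * n.-1%:R)^-1 * (m.-1%:R / x.-1%:R) =
    \sum_(b in before n m :\ p) prob (fun s => A s && best_at s (before n x :\ p) b) :> R.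
  transitivity (\sum_(b in before n m :\ p) ((n%:R * n.-1%:R)^-1 / x.-1%:R) : R).
    by rewrite sumr_const card_beforeD1 // -[RHS]mulr_natr mulrAC mulrA.
  apply: eq_bigr => b; rewrite !inE => /andP[neq_bp lt_bm].
  rewrite prob_best; first by rewrite probA card_beforeD1 // ltnW.
    by apply: swap_invariantI; apply: swap_invariant_at; rewrite !inE ?eqxx ?ltnn ?andbF.
  by rewrite !inE neq_bp /=; lia.
apply: prob_sum_le => [b s|b b' s]; last first.
  by move=> /andP[_ best_b] /andP[_ best_b']; exact: best_at_uniq best_b best_b'.
rewrite !inE => /andP[neq_bp lt_bm] /andP[/andP[/eqP eq_x /eqP eq_p] best_b].
have best_p : best_at s (before n x) p.
  by apply/best_atP; split=> [|q _]; rewrite ?inE // eq_p j0.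
rewrite best_p eq_p -eq_x !eqxx !andbT /=.
apply: (accept_best2_in_sample itemv m_gt1 lt_pm lt_bm le_mx best_p best_b).
apply: lt_x; rewrite // -?eq_p ?(inj_eq perm_inj) // -val_eqE /=; lia.
Qed.

End AcceptanceProbability.

(** * Bounds and identities for harmonic sums *)

Section HarmonicSums.
Context {R : realFieldType}.
Implicit Types (m n k l u w q : nat).

(* A Pade approximant of [ln (y / x)]. *)
Definition pade_ln (x y : R) : R :=
  3 * (y ^+ 2 - x ^+ 2) / (y ^+ 2 + 4 * x * y + x ^+ 2).

(** Both sides vanish at [w = u], and a step from x to x + 1 raises the approximant by at most 1/x,
    the term that the sum gains. *)
Lemma harmonic_slice_ge u w : (0 < u)%N -> (u <= w)%N ->
  pade_ln u%:R w%:R <= \sum_(u <= k < w) k%:R^-1 :> R.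
Proof.
rewrite /pade_ln => u_gt0 le_uw; rewrite -(subnKC le_uw); elim: (w - u)%N => [|d IHd].
  by rewrite addn0 big_geq // subrr mulr0 mul0r.
rewrite addnS big_nat_recr ?leq_addr //= -[(u + d).+1%:R]natr1.
apply: le_trans (lerD IHd (lexx _)); rewrite -lerBlDl.
have u0 : 0 < u%:R :> R by rewrite ltr0n.
have x0 : 0 < (u + d)%:R :> R by rewrite ltr0n; lia.
move: (u + d)%:R x0 (u%:R : R) u0 => x x0 y y0.
pose a := x ^+ 2 + 4 * y * x + y ^+ 2.
pose b := (x + 1) ^+ 2 + 4 * y * (x + 1) + y ^+ 2.
have a0 : 0 < a by rewrite /a; nra.
have b0 : 0 < b by rewrite /b; nra.
rewrite -/a -/b -subr_ge0.
have -> : x^-1 - (3 * ((x + 1) ^+ 2 - y ^+ 2) / b - 3 * (x ^+ 2 - y ^+ 2) / a) =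
    ((x - y) ^+ 4 + 2 * x ^+ 3 + 12 * y ^+ 2 * x + 4 * y ^+ 3 + a) / (x * a * b).
  by rewrite /a /b; field; rewrite -/a -/b !gt_eqF.
apply: divr_ge0; last by rewrite !mulr_ge0 // ltW.
have xy4 : 0 <= (x - y) ^+ 4 by rewrite exprn_even_ge0.
have x3 : 0 < x ^+ 3 by rewrite exprn_gt0.
have y3 : 0 < y ^+ 3 by rewrite exprn_gt0.
have y2x : 0 < y ^+ 2 * x by rewrite mulr_gt0 ?exprn_gt0.
by rewrite -[12 * _ * _]mulrA; lra.
Qed.

(** [pade_ln] is homogeneous of degree 0, so [q] cancels. *)
Lemma harmonic_slice_scaled a b q : (0 < q)%N -> (0 < a)%N -> (a <= b)%N ->
  pade_ln a%:R b%:R <= \sum_(a * q <= k < b * q) k%:R^-1.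
Proof.
move=> q0 a0 le_ab.
apply: le_trans (harmonic_slice_ge _ _); rewrite ?muln_gt0 ?a0 ?leq_mul2r ?le_ab ?orbT //.
have q0' : 0 < q%:R :> R by rewrite ltr0n.
have a0' : 0 < a%:R :> R by rewrite ltr0n.
have b0' : 0 < b%:R :> R by rewrite ltr0n; lia.
rewrite /pade_ln le_eqVlt !natrM; apply/orP; left; apply/eqP; field.
by rewrite !gt_eqF // !addr_gt0 ?mulr_gt0 ?exprn_gt0 ?mulr_gt0.
Qed.

(** The approximant is sharper for ratios near 1, hence the three slices. *)
Lemma harmonic_slice3_ge a b c d q : (0 < q)%N -> (0 < a)%N ->
  (a <= b)%N -> (b <= c)%N -> (c <= d)%N ->
  pade_ln a%:R b%:R + (pade_ln b%:R c%:R + pade_ln c%:R d%:R)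
    <= \sum_(a * q <= k < d * q) k%:R^-1.
Proof.
move=> q0 a0 le_ab le_bc le_cd.
have b0 := leq_trans a0 le_ab; have c0 := leq_trans b0 le_bc.
rewrite (@big_cat_nat _ _ _ (b * q) (a * q)) ?leq_mul2r ?le_ab ?(leq_trans le_bc) ?orbT //=.
rewrite (@big_cat_nat _ _ _ (c * q) (b * q)) ?leq_mul2r ?le_bc ?le_cd ?orbT //=.
by rewrite !lerD // harmonic_slice_scaled.
Qed.

Lemma sum_invr_pred m n : (1 < m)%N -> (m <= n)%N ->
  \sum_(m <= k < n) k.-1%:R^-1 =
    \sum_(m <= k < n) k%:R^-1 + m.-1%:R^-1 - n.-1%:R^-1 :> R.
Proof.
move=> m1 le_mn; rewrite -(subnKC le_mn); elim: (n - m)%N => [|d IHd].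
  by rewrite addn0 !big_geq // add0r subrr.
rewrite addnS !big_nat_recr ?leq_addr //= IHd; ring.
Qed.

(** Summation by parts with 1/(k (k - 1)) = 1/(k - 1) - 1/k, checked by induction. *)
Lemma sum_invr_double m n : (1 < m)%N -> (m <= n)%N ->
  \sum_(m <= k < n) (\sum_(m <= l < k) l.-1%:R^-1) / (k%:R * k.-1%:R) =
    m.-1%:R^-1 - (1 + \sum_(m <= l < n) l.-1%:R^-1) / n.-1%:R :> R.
Proof.
move=> m1 le_mn; rewrite -(subnKC le_mn); elim: (n - m)%N => [|d IHd].
  by rewrite addn0 !big_geq // addr0 mul1r subrr.
rewrite addnS !big_nat_recr ?leq_addr //= IHd.
have -> : (m + d)%N = (m + d).-1.+1 by lia.
rewrite /= -[(m + d).-1.+1%:R]natr1; set x : R := (m + d).-1%:R.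
have x0 : 0 < x by rewrite ltr0n; lia.
have y0 : 0 < m.-1%:R :> R by rewrite ltr0n; lia.
by field; rewrite !gt_eqF // addr_gt0.
Qed.

(* The breakpoints are nearly in geometric progression. *)
Lemma harmonic_slice_numeric q : (0 < q)%N ->
  10436 / 10 ^+ 4 <= \sum_(3521 * q <= k < 10 ^ 4 * q) k%:R^-1 :> R.
Proof.
(* For large [q] the sum tends to ln(10^4 / 3521), about 1.0438; each slice gives about a third,
   rounded down. *)
have num : 10436 / 10 ^+ 4 <=
    3478 / 10 ^+ 4 + (3479 / 10 ^+ 4 + 3479 / 10 ^+ 4) :> R by lra.
have h1 : 3478 / 10 ^+ 4 <= pade_ln 3521 4986.
  by clear; rewrite /pade_ln ler_pdivlMr; lra.
have h2 : 3479 / 10 ^+ 4 <= pade_ln 4986 7061.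
  by clear; rewrite /pade_ln ler_pdivlMr; lra.
have h3 : 3479 / 10 ^+ 4 <= pade_ln 7061 (10 ^ 4)%:R.
  by clear; rewrite natrX /pade_ln ler_pdivlMr; lra.
move=> q0; have h := le_trans num (lerD h1 (lerD h2 h3)).
exact: le_trans h (@harmonic_slice3_ge 3521 4986 7061 (10 ^ 4) q q0 isT isT isT isT).
Qed.

End HarmonicSums.

(** * Closed forms and the competitive ratio *)

Section CompetitiveRatio.
Context {R : realType}.

Lemma sum_selected_weight m n : (1 < m)%N -> (m <= n)%N ->
  \sum_(m <= k < n) @selected_weight R n m k =
  m%:R / n%:R * (1 - m.-1%:R / n.-1%:R * (1 + \sum_(m <= k < n) k.-1%:R^-1)).
Proof.
move=> m1 le_mn; set K := (X in _ * (1 + X)).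
have M0 : 0 < m.-1%:R :> R by rewrite ltr0n; lia.
transitivity (m%:R * m.-1%:R / n%:R *
    \sum_(m <= k < n) (\sum_(m <= l < k) l.-1%:R^-1) / (k%:R * k.-1%:R) : R).
  rewrite mulr_sumr; apply: eq_bigr => k _.
  rewrite mulrA mulr_sumr mulr_suml /selected_weight; apply: eq_bigr => l _.
  by rewrite !invfM; ring.
rewrite sum_invr_double // -/K.
have -> : m.-1%:R^-1 - (1 + K) / n.-1%:R = m.-1%:R^-1 * (1 - m.-1%:R / n.-1%:R * (1 + K)).
  by rewrite mulrBr mulr1 !mulrA mulVf ?gt_eqF // mul1r; ring.
by rewrite mulrA; congr (_ * _); rewrite [LHS]mulrAC mulfK // gt_eqF.
Qed.

Lemma sum_first_weight m n : (1 < m)%N -> (m <= n)%N ->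
  \sum_(m <= k < n) (m%:R * (n%:R * k%:R)^-1 + @selected_weight R n m k) =
  m%:R / n%:R * (\sum_(m <= k < n) k%:R^-1 +
                 (1 - m.-1%:R / n.-1%:R * (1 + \sum_(m <= k < n) k.-1%:R^-1))).
Proof.
move=> m1 le_mn; rewrite big_split /= sum_selected_weight // [RHS]mulrDr; congr (_ + _).
by rewrite mulr_sumr; apply: eq_bigr => k _; rewrite invfM mulrA.
Qed.

(** The loss due to the best item lying in the sample cancels exactly against the total of
    [selected_weight]. *)
Lemma sum_second_weight m n : (1 < m)%N -> (m < n)%N ->
  \sum_(m <= k < n) (m%:R * ((n%:R * k%:R)^-1
      - (n%:R * n.-1%:R)^-1 * (1 - m.-1%:R / k.-1%:R)) + @selected_weight R n m k) =
  m%:R / n%:R * \sum_(m <= k < n) k%:R^-1.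
Proof.
move=> m1 lt_mn; have le_mn := ltnW lt_mn.
transitivity (\sum_(m <= k < n) (m%:R * (n%:R * k%:R)^-1 + @selected_weight R n m k)
   - m%:R / (n%:R * n.-1%:R) * \sum_(m <= k < n) (1 - m.-1%:R / k.-1%:R)).
  by rewrite mulr_sumr -sumrB; apply: eq_bigr => k _; ring.
rewrite sum_first_weight // sumrB -mulr_sumr sumr_const_nat natrB //.
have N0 : 0 < n.-1%:R :> R by rewrite ltr0n; lia.
have -> : n%:R = n.-1%:R + 1 :> R by rewrite natr1 prednK //; lia.
have -> : m%:R = m.-1%:R + 1 :> R by rewrite natr1 prednK //; lia.
by field; rewrite !gt_eqF // ltr_wpDr.
Qed.

Lemma sum_first_ge_second m n : (1 < m)%N -> (m <= n)%N ->
  \sum_(m <= k < n) (m%:R * ((n%:R * k%:R)^-1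
      - (n%:R * n.-1%:R)^-1 * (1 - m.-1%:R / k.-1%:R)) + @selected_weight R n m k) <=
  \sum_(m <= k < n) (m%:R * (n%:R * k%:R)^-1 + @selected_weight R n m k).
Proof.
move=> m1 le_mn; rewrite big_nat_cond [leRHS]big_nat_cond; apply: ler_sum => k.
rewrite andbT => /andP[le_mk lt_kn].
rewrite lerD2r ler_wpM2l // gerBl mulr_ge0 ?invr_ge0 ?mulr_ge0 //.
by rewrite subr_ge0 ler_pdivrMr ?mul1r ?ler_nat ?ltr0n; lia.
Qed.

Lemma expected_ALG_ge n (v : 'I_n -> R) (i j : 'I_n) k t :
  item_values v -> i != j ->
  v i * prob (fun s => i \in optimistic v k t (arrivals s)) +
  v j * prob (fun s => j \in optimistic v k t (arrivals s)) <= expected_ALG v k t.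
Proof.
move=> [v_gt0 _] neq_ij; rewrite /prob !mulrA -mulrDl.
rewrite ler_pM2r ?invr_gt0 ?fact_gt0R // !card_predE !natr_sum !mulr_sumr -big_split /=.
apply: ler_sum => s _; rewrite /ALG.
set l := optimistic _ _ _ _.
have l_uniq : uniq l.
  apply: subseq_uniq (uniq_arrivals s).
  exact: subseq_trans (select_subseq _ _ _) (drop_subseq _ _).
rewrite big_uniq //=.
have vE x : v x * (x \in l)%:R = if x \in l then v x else 0.
  by case: ifP; rewrite ?mulr1 ?mulr0.
rewrite big_mkcond (bigD1 i) //= (bigD1 j) 1?eq_sym //= -!vE addrA lerDl.
by rewrite sumr_ge0 // => x _; case: ifP => // _; exact: ltW.
Qed.

(** With [A] and [K] at their upper bounds the right-hand side increases with [h]; at 1.0436 it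
    leaves a margin of about 10^-5. The constant 3520 is the least possible m - 1. *)
Lemma ratio_numeric (h A K : R) : 10436 / 10 ^+ 4 <= h -> A <= 3521 / 10 ^+ 4 ->
  0 <= K -> K <= h + 3520^-1 ->
  4168 / 10 ^+ 4 * 2 <= 3521 / 10 ^+ 4 * (h + (1 - A * (1 + K))) + 3521 / 10 ^+ 4 * h.
Proof.
move=> le_h le_A K0 le_K.
have le_AK : A * (1 + K) <= 3521 / 10 ^+ 4 * (1 + K) by rewrite ler_wpM2r ?addr_ge0.
by move: le_AK; move: (A * (1 + K)) => P; lra.
Qed.

End CompetitiveRatio.

(** Chebyshev's sum inequality for two terms, from (a - b) (x - y) >= 0. *)
Lemma weighted_sum_ge (R : realFieldType) (r a b x y : R) :
  0 <= b -> b <= a -> y <= x -> r * 2 <= x + y -> r * (a + b) <= a * x + b * y.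
Proof. by move=> *; nra. Qed.

Lemma sum_invr_pred_le (R : realFieldType) m n (x : R) :
  (1 < m)%N -> (m <= n)%N -> 0 < x -> x <= m.-1%:R ->
  \sum_(m <= k < n) k.-1%:R^-1 <= \sum_(m <= k < n) k%:R^-1 + x^-1 :> R.
Proof.
move=> m1 le_mn x0 le_x; rewrite sum_invr_pred // lerBlDr -addrA lerD2l.
by apply: ler_wpDr; rewrite ?invr_ge0 // lef_pV2 ?posrE // (lt_le_trans x0).
Qed.

(** 3521 is coprime to 10^4, so 10^4 divides [n]. *)
Lemma sample_size_scaled (R : realType) (m n : nat) :
  m%:R = 3521 / 10 ^+ 4 * n%:R :> R ->
  exists q, m = (3521 * q)%N /\ n = (10 ^ 4 * q)%N.
Proof.
move=> eq_m.
have eq_nat : (10 ^ 4 * m = 3521 * n)%N.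
  apply/eqP; rewrite -(eqr_nat R) (natrM R (10 ^ 4)) (natrM R 3521) natrX eq_m.
  by rewrite mulrA mulrCA divff ?mulr1 // expf_neq0 // pnatr_eq0.
have : (10 ^ 4 %| 3521 * n)%N by rewrite -eq_nat dvdn_mulr.
rewrite Gauss_dvdr; last by rewrite coprimeXl.
case/dvdnP=> q eq_n; exists q; rewrite [in RHS]mulnC; split=> //; last by rewrite mulnC.
apply/eqP; rewrite -(@eqn_pmul2l (10 ^ 4)) ?expn_gt0 // eq_nat eq_n.
by rewrite mulnCA [X in _ == X]mulnC mulnA mulnC.
Qed.

Local Open Scope classical_set_scope.
Local Open Scope ring_scope.

Theorem theorem15 (R : realType) :
  exists o : nat -> R,
    o n @[n --> \oo] --> (0 : R) /\
    forall n t : nat,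
      (2 < t)%N -> (t <= n - 2)%N ->
      t%:R - 1 = (3521 / 10 ^+ 4) * n%:R :> R ->
      forall v : 'I_n -> R, item_values v ->
        (4168 / 10 ^+ 4 - o n) * OPT v 2 <= expected_ALG v 2 t.
Proof.
exists (fun=> 0); split; first exact: cvg_cst.
move=> n [//|m] m_gt1 le_tn eq_t v itemv; rewrite ltnS in m_gt1.
rewrite -natr1 addrK in eq_t.
have lt_mn : (m < n)%N by lia.
have n_gt1 : (1 < n)%N by lia.
have le_mn := ltnW lt_mn.
(* [j] is the best item and [i] the second best. *)
pose j := Ordinal (ltnW n_gt1); pose i := Ordinal n_gt1.
have neq_ji : j != i by [].
have v_dec : v i < v j by case: itemv => _; apply.
have vi_gt0 : 0 < v i by case: itemv.
rewrite subr0; apply: le_trans (expected_ALG_ge 2 m.+1 itemv neq_ji).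
have -> : OPT v 2 = v j + v i.
  rewrite /OPT (big_ord_narrow n_gt1) big_ord_recl big_ord1.
  by congr (v _ + v _); exact: val_inj.
have := @prob_accept_second R n v itemv m m_gt1 le_mn i j erefl erefl.
have := @prob_accept_first R n v itemv m m_gt1 le_mn j erefl.
have := @sum_first_ge_second R m n m_gt1 le_mn.
rewrite sum_first_weight // sum_second_weight //.
set P0 := prob _; set P1 := prob _.
have n_gt0 : 0 < n%:R :> R by rewrite ltr0n; lia.
have N_gt0 : 0 < n.-1%:R :> R by rewrite ltr0n; lia.
have -> : m%:R / n%:R = 3521 / 10 ^+ 4 :> R by rewrite eq_t mulfK ?gt_eqF.
(* With c = 0.3521 and m = c n, clearing the denominator and adding c leaves m - 1 + c <= m. *)
have le_A : m.-1%:R / n.-1%:R <= 3521 / 10 ^+ 4 :> R.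
  rewrite ler_pdivrMr // -(lerD2r (3521 / 10 ^+ 4)).
  rewrite -[X in _ <= _ + X]mulr1 -mulrDr natr1 prednK ?(ltnW n_gt1) // -eq_t.
  have -> : m%:R = m.-1%:R + 1 :> R by rewrite natr1 prednK // ltnW.
  by rewrite lerD2l; clear; lra.
have [q [eq_m eq_n]] := sample_size_scaled eq_t.
have q_gt0 : (0 < q)%N by case: q eq_m m_gt1 {eq_n} => // ->; rewrite muln0.
have le_M : 3520 <= m.-1%:R :> R.
  rewrite ler_nat -(leq_add2r 1) !addn1 (prednK (ltnW m_gt1)) eq_m.
  exact: (leq_pmulr 3521 q_gt0).
have le_h := @harmonic_slice_numeric R q q_gt0.
rewrite -eq_m -eq_n in le_h.
have K_ge0 : 0 <= \sum_(m <= k < n) k.-1%:R^-1 :> R.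
  by rewrite sumr_ge0 // => k _; rewrite invr_ge0.
have le_K : \sum_(m <= k < n) k.-1%:R^-1 <= \sum_(m <= k < n) k%:R^-1 + 3520^-1 :> R.
  by apply: sum_invr_pred_le; rewrite ?ltr0n.
have := ratio_numeric le_h le_A K_ge0 le_K.
set S0 : R := _ * (_ + (1 - _)); set S1 : R := _ * \sum_(m <= k < n) k%:R^-1.
move=> sum_ge le_S le_P0 le_P1.
apply: (@le_trans _ _ (v j * S0 + v i * S1)).
  exact: weighted_sum_ge (ltW vi_gt0) (ltW v_dec) le_S sum_ge.
by rewrite lerD // ler_wpM2l // ltW // (lt_trans vi_gt0).
Qed.
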